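(* For any integer $k\geq 2$, $gr_{k}^{*}(K_{3}: C_{4})=k+3$.
   Context: All graphs are finite and simple; $C_4$ is the cycle on 4 vertices. A $k$-edge-coloring uses colors from $[k]=\{1,\ldots,k\}$. A subgraph is monochromatic if all its edges have the same color and rainbow if no two of its edges have the same color. The Gallai-Ramsey number $gr_k(K_3: H)$ is the smallest integer $n$ such that every $k$-edge-colored $K_n$ contains either a rainbow $K_3$ or a monochromatic copy of $H$. For $n=gr_k(K_3:H)$ and $0\le s\le n-1$, $K_{n-1}\sqcup K_{1,s}$ denotes the graph obtained from $K_{n-1}$ by adding a new vertex $v$ and $s$ edges joining $v$ to $s$ vertices of $K_{n-1}$. The star-critical Gallai-Ramsey number $gr_k^{*}(K_3: H)$ is the smallest integer $s$ such that every $k$-edge-colored $K_{n-1}\sqcup K_{1,s}$ contains either a rainbow $K_3$ or a monochromatic copy of $H$. (It is known that $gr_k(K_3:C_4)=k+4$ for $k\ge 2$.) *)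

(* Defs.v *)
From mathcomp Require Import all_boot.

Set Implicit Arguments.
Unset Strict Implicit.
Unset Printing Implicit Defensive.

Record sgraph := SGraph {
  vertex :> finType;
  adj : rel vertex;
  adj_sym : symmetric adj;
  adj_irrefl : irreflexive adj }.

Definition edges (G : sgraph) : {set {set G}} :=
  [set e | [exists x : G, exists y : G, adj x y && (e == [set x; y])]].

Lemma complete_sym (T : finType) : symmetric (fun x y : T => x != y).
Proof. by move=> x y; rewrite eq_sym. Qed.

Lemma complete_irrefl (T : finType) : irreflexive (fun x y : T => x != y).
Proof. by move=> x; rewrite eqxx. Qed.

Definition complete (n : nat) : sgraph :=
  SGraph (@complete_sym 'I_n) (@complete_irrefl 'I_n).

Definition C4_adj : rel 'I_4 := fun i j => (j == ordS i) || (i == ordS j).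

Lemma C4_sym : symmetric C4_adj.
Proof. by move=> i j; rewrite /C4_adj orbC. Qed.

Lemma C4_irrefl : irreflexive C4_adj.
Proof. by case=> [[|[|[|[|]]]]]. Qed.

Definition C4 : sgraph := SGraph C4_sym C4_irrefl.

(* K_m with a new vertex [None] joined to the s vertices 0, ..., s-1 of K_m;
   this is the intended graph only for s <= m.  By the symmetry of K_m the
   choice of the s neighbours does not matter up to isomorphism. *)
Definition complete_star_adj (m s : nat) : rel (option 'I_m) := fun x y =>
  match x, y with
  | Some i, Some j => i != j
  | Some i, None | None, Some i => i < s
  | None, None => false
  end.

Lemma complete_star_sym m s : symmetric (@complete_star_adj m s).
Proof. by move=> [i|] [j|] //=; rewrite eq_sym. Qed.

Lemma complete_star_irrefl m s : irreflexive (@complete_star_adj m s).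
Proof. by move=> [i|] //=; rewrite eqxx. Qed.

Definition complete_star (m s : nat) : sgraph :=
  SGraph (@complete_star_sym m s) (@complete_star_irrefl m s).

(* A coloring is a total function on vertex sets, of which only the values on
   edges are constrained or ever used. *)
Definition edge_coloring (k : nat) (G : sgraph) (c : {set G} -> nat) : Prop :=
  forall e, e \in edges G -> 1 <= c e <= k.

(* [f] exhibits a (not necessarily induced) subgraph of G isomorphic to H *)
Definition is_copy (H G : sgraph) (f : H -> G) : Prop :=
  injective f /\ forall x y, adj x y -> adj (f x) (f y).

Definition has_monochromatic (H G : sgraph) (c : {set G} -> nat) : Prop :=
  exists f : H -> G, is_copy f /\
    forall e1 e2, e1 \in edges H -> e2 \in edges H ->
      c (f @: e1) = c (f @: e2).

Definition has_rainbow (H G : sgraph) (c : {set G} -> nat) : Prop :=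
  exists f : H -> G, is_copy f /\
    forall e1 e2, e1 \in edges H -> e2 \in edges H -> e1 != e2 ->
      c (f @: e1) <> c (f @: e2).

Definition forces (k : nat) (H G : sgraph) : Prop :=
  forall c : {set G} -> nat, edge_coloring k c ->
    has_rainbow (complete 3) c \/ has_monochromatic H c.

Definition is_least (P : nat -> Prop) (n : nat) : Prop :=
  P n /\ forall m, P m -> n <= m.

(* gr_k(K_3 : H) = n *)
Definition gallai_ramsey (k : nat) (H : sgraph) (n : nat) : Prop :=
  is_least (fun n => forces k H (complete n)) n.

(* gr*_k(K_3 : H) = s, including the existence of n = gr_k(K_3 : H) *)
Definition star_critical_gallai_ramsey (k : nat) (H : sgraph) (s : nat) : Prop :=
  exists n, gallai_ramsey k H n /\
    is_least (fun s => s <= n.-1 /\ forces k H (complete_star n.-1 s)) s.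

(* Main.v *)
(* Upper bound: let f be the number of colors that occur on two adjacent edges.
   A coloring of K_n without rainbow triangle or monochromatic C_4 satisfies
   n <= f + 3.  For n >= 6 such a coloring has a vertex v all of whose edges
   have one color c; deleting v destroys all adjacent pairs of edges of color c,
   as such a pair x - y - z would close to the 4-cycle v x y z, so n and f both
   drop until n <= 5.  The vertex v exists for n = 6 by exhaustive search and then for every
   n by induction: if v is such a vertex in the coloring minus x, then v or x is
   one in the whole coloring.

   Lower bound: color K_6 minus an edge with two colors and no monochromatic
   C_4, then add vertices one at a time, each joined to all earlier ones in a
   new color.  The result is a coloring of K_{k+4} minus an edge. *)
Require Import Defs.
From mathcomp Require Import all_boot zify.

Set Implicit Arguments.
Unset Strict Implicit.
Unset Printing Implicit Defensive.

(** * Exhaustive search over colorings of small complete graphs *)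

(** Here [i < j] is the pair just colored. The only other colored pairs at [j] are [a j] with
    [a < i], so each fully colored triangle or 4-cycle through [i j] contains such an [a]. If [a j]
    and [i j] agree, the triangle is harmless and only the cycles [i j a w] remain to be tested. *)
Definition conflict (f : nat -> nat -> nat) (i j : nat) : bool :=
  let c := f i j in
  has (fun a =>
    let x := f a i in
    let y := f a j in
    if c == y then
      has (fun w => if f a w == c then [&& f i w == c, w != a & w != i]
                    else false) (iota 0 j)
    else if x == c then false else x != y)
    (iota 0 i).

Definition update (f : nat -> nat -> nat) (i j v a b : nat) : nat :=
  if a == i then (if b == j then v else f a b)
  else if a == j then (if b == i then v else f a b) else f a b.

(* The pairs are colored in the order 01, 02, 12, 03, 13, 23, ...; [m] is the
   number of colors used so far, so that a new color may be taken to be [m].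
   The [if]s, unlike [||], prevent call-by-value evaluation of the branches that
   have been pruned. *)
Fixpoint search (N : nat) (goal : (nat -> nat -> nat) -> bool)
    (fuel i j m : nat) (f : nat -> nat -> nat) : bool :=
  if j == N then goal f else
  if fuel is n.+1 then
    all (fun v =>
      let f' := update f i j v in
      if conflict f' i j then true else
      let m' := maxn m v.+1 in
      if i.+1 == j then search N goal n 0 j.+1 m' f'
      else search N goal n i.+1 j m' f')
      (iota 0 m.+1)
  else false.

Definition dominated_goal (N : nat) (f : nat -> nat -> nat) : bool :=
  has (fun v => all (fun u => all (fun w =>
    if u == v then true else if w == v then true else f v u == f v w) (iota 0 N)) (iota 0 N)) (iota 0 N).

(** An entry [p = (v, (x, y))] is a path [x - v - y] with both edges of one color. A non-constant
    list of their colors means that at least two colors occur on such paths. *)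
Definition cherries_goal (N : nat) (f : nat -> nat -> nat) : bool :=
  ~~ constant [seq f p.1 p.2.1 |
    p <- [seq (v, q) | v <- iota 0 N, q <- [seq (x, y) | x <- iota 0 N, y <- iota 0 N]]
    & uniq [:: p.1; p.2.1; p.2.2] && (f p.1 p.2.1 == f p.1 p.2.2)].

(** The fuel is the number of pairs: 15 for six vertices, and 10 for five below. *)
Lemma search_dominated : search 6 (dominated_goal 6) 15 0 1 0 (fun _ _ => 0).
Proof. by vm_compute. Qed.

Lemma search_cherries : search 5 (cherries_goal 5) 10 0 1 0 (fun _ _ => 0).
Proof. by vm_compute. Qed.

(* The pairs that precede [ij] in the order of [search]. *)
Definition colored (i j a b : nat) : bool :=
  (a != b) && ((maxn a b < j) || (maxn a b == j) && (minn a b < i)).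

(** The search meets a coloring only up to an injective renaming of colors, which is captured by
    comparing the patterns of equal colors. *)
Definition renames (C : eqType) (D : rel nat) (g : nat -> nat -> C)
    (f : nat -> nat -> nat) : Prop :=
  forall a b a' b', D a b -> D a' b' -> (f a b == f a' b') = (g a b == g a' b').

Section Coloring.

Variables (T C : finType) (col : T -> T -> C).
Hypothesis colC : forall x y, col x y = col y x.
Hypothesis gallai : forall x y z, uniq [:: x; y; z] ->
  [|| col x y == col y z, col y z == col x z | col x y == col x z].
Hypothesis noC4 : forall x y z w, uniq [:: x; y; z; w] ->
  ~~ [&& col x y == col y z, col y z == col z w & col z w == col w x].

(** * Soundness of the search *)

Section Search.

Variables (x0 : T) (s : seq T).
Hypothesis s_uniq : uniq s.
Let g a b := col (nth x0 s a) (nth x0 s b).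

Lemma gC a b : g a b = g b a. Proof. exact: colC. Qed.

Lemma uniq_nth t : {subset t <= gtn (size s)} -> uniq t -> uniq (map (nth x0 s) t).
Proof.
move=> ts; rewrite map_inj_in_uniq // => a b /ts a_s /ts b_s /eqP.
by rewrite nth_uniq // => /eqP.
Qed.

Lemma no_conflict f i j : i < j < size s ->
  renames (colored i.+1 j) g f -> ~~ conflict f i j.
Proof.
move=> /andP[ij js] fg; apply/hasPn=> a; rewrite mem_iota => /andP[_ ai] /=.
have cij : colored i.+1 j i j by rewrite /colored; lia.
have cai : colored i.+1 j a i by rewrite /colored; lia.
have caj : colored i.+1 j a j by rewrite /colored; lia.
case: ifP => [|ij_aj].
  rewrite fg // => /eqP ij_aj; apply/hasPn=> w; rewrite mem_iota => /andP[_ wj].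
  case: ifP => // aw; apply/negP=> /and3P[iw wa wi].
  have caw : colored i.+1 j a w by rewrite /colored; lia.
  have ciw : colored i.+1 j i w by rewrite /colored; lia.
  move: aw iw; rewrite !fg // => /eqP aw /eqP iw.
  have /noC4 : uniq (map (nth x0 s) [:: w; i; j; a]).
    by apply: uniq_nth; [move=> u; rewrite !inE; lia | rewrite /= !inE; lia].
  by rewrite -!/(g _ _) (gC w) iw (gC j a) -ij_aj aw !eqxx.
case: ifP => // ai_ij; apply/negP=> ai_aj.
have /gallai : uniq (map (nth x0 s) [:: a; i; j]).
  by apply: uniq_nth; [move=> u; rewrite !inE; lia | rewrite /= !inE; lia].
by move: ij_aj ai_ij ai_aj; rewrite -!/(g _ _) !fg // => -> -> /negPf ->.
Qed.

Lemma update_new f i j v a b :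
  colored i.+1 j a b -> ~~ colored i j a b -> update f i j v a b = v /\ g a b = g i j.
Proof.
move=> new old; have [[-> ->]|[-> ->]] : (a = i /\ b = j) \/ (a = j /\ b = i).
- by move: new old; rewrite /colored; lia.
- by rewrite /update !eqxx.
- by rewrite /update !eqxx gC; case: eqP => [->|]; rewrite ?eqxx.
Qed.

Lemma update_old f i j v a b : i < j -> colored i j a b -> update f i j v a b = f a b.
Proof.
rewrite /update /colored => ij old.
by case: (a =P i) => ?; case: (b =P j) => ?; case: (a =P j) => ?; case: (b =P i) => ? //; lia.
Qed.

(** The given coloring [g] singles out one branch at each pair: the color already used for an
    earlier pair of the same [g]-color, or else the new color [m]. By [no_conflict] this branch is
    never pruned, so the goal holds at its leaf. *)
Lemma search_sound goal n i j m f :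
    i < j <= size s -> search (size s) goal n i j m f ->
    renames (colored i j) g f -> (forall a b, colored i j a b -> f a b < m) ->
  exists2 f', goal f' & renames (colored 0 (size s)) g f'.
Proof.
elim: n i j m f => [|n IHn] i j m f /andP[ij js]; cbn [search].
  case: eqP => // jN gf fg _; exists f => // a b a' b' ab ab'.
  by apply: fg; move: ab ab'; rewrite /colored; lia.
case: eqP => [jN gf fg _|jN sf fg fm].
  exists f => // a b a' b' ab ab'.
  by apply: fg; move: ab ab'; rewrite /colored; lia.
have [v v_m vg] : exists2 v, v <= m &
    forall a b, colored i j a b -> (f a b == v) = (g a b == g i j).
  case: (boolP [exists a : 'I_j.+1, exists b : 'I_j.+1,
                colored i j a b && (g a b == g i j)]) => [|none].
    move=> /existsP[a /existsP[b /andP[ab /eqP gab]]]; exists (f a b); first exact/ltnW/fm.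
    by move=> a' b' ab'; rewrite fg // gab.
  exists m => // a b ab; rewrite ltn_eqF ?fm //; apply/esym/negP=> gab.
  have [aj bj] : a < j.+1 /\ b < j.+1 by move: ab; rewrite /colored; lia.
  case/negP: none; apply/existsP; exists (Ordinal aj); apply/existsP.
  by exists (Ordinal bj); rewrite ab gab.
have {vg fg} fg : renames (colored i.+1 j) g (update f i j v).
  move=> a b a' b' ab ab'.
  case: (boolP (colored i j a b)) (@update_new f i j v a b ab) => [old _|_ /(_ isT)[-> ->]];
  case: (boolP (colored i j a' b')) (@update_new f i j v a' b' ab') => [old' _|_ /(_ isT)[-> ->]];
    rewrite ?eqxx ?update_old ?vg ?fg //.
  by rewrite eq_sym vg // eq_sym.
have {}fm a b : colored i.+1 j a b -> update f i j v a b < maxn m v.+1.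
  move=> ab; case: (boolP (colored i j a b)) => [old|/(update_new f v ab)[-> _]].
    by rewrite update_old // leq_max fm.
  by rewrite leq_max ltnSn orbT.
have js' : i < j < size s by lia.
have v_in : v \in iota 0 m.+1 by rewrite mem_iota; lia.
have := allP sf v v_in; rewrite /= (negPf (no_conflict js' fg)).
case: eqP => [ij1|ij1] /IHn; apply; try lia.
- move=> a b a' b' ab ab'; apply: fg; move: ab ab'; rewrite /colored; lia.
- move=> a b ab; apply: fm; move: ab; rewrite /colored; lia.
- by [].
- by [].
Qed.

End Search.

(** * Dominating vertices and colors on adjacent edges *)

Definition dominates (v : T) (A : {set T}) : Prop :=
  {in A :\ v &, forall x y, col v x = col v y}.

Definition cherry (A : {set T}) (c : C) : bool :=
  [exists v in A, exists x in A, exists y in A,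
    [&& uniq [:: v; x; y], col v x == c & col v y == c]].

(** A set of colors, not of paths; its cardinality is what drops along with [#|A|]. *)
Definition cherries (A : {set T}) : {set C} := [set c | cherry A c].

Lemma cherryP (A : {set T}) v x y : v \in A -> x \in A -> y \in A -> uniq [:: v; x; y] ->
  col v x = col v y -> col v x \in cherries A.
Proof.
move=> vA xA yA vxy e; rewrite inE; apply/exists_inP; exists v => //.
by apply/exists_inP; exists x => //; apply/exists_inP; exists y; rewrite // vxy e eqxx.
Qed.

Lemma set_search (A : {set T}) goal n x0 : x0 \in A ->
    search #|A| goal n 0 1 0 (fun _ _ => 0) ->
  exists2 f, goal f &
    renames (colored 0 #|A|) (fun a b => col (nth x0 (enum A) a) (nth x0 (enum A) b)) f.
Proof.
move=> x0A; rewrite cardE => /search_sound; apply.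
- exact: enum_uniq.
- by rewrite -cardE; apply/card_gt0P; exists x0.
- by move=> a b a' b'; rewrite /colored; lia.
- by move=> a b; rewrite /colored; lia.
Qed.

Lemma dominated6 (A : {set T}) : #|A| = 6 -> exists2 v, v \in A & dominates v A.
Proof.
move=> A6; have /card_gt0P[x0 x0A] : 0 < #|A| by rewrite A6.
have sA : size (enum A) = 6 by rewrite -cardE.
have := @set_search A (dominated_goal 6) 15 x0 x0A.
rewrite A6 => /(_ search_dominated)[f /hasP[a]].
rewrite mem_iota => /andP[_ a6] /allP fa fcol.
exists (nth x0 (enum A) a) => [|x y]; first by rewrite -mem_enum mem_nth ?sA.
rewrite !in_setD1 => /andP[xv] + /andP[yv]; rewrite -[x \in A]mem_enum -[y \in A]mem_enum => xA yA.
have xi : index x (enum A) < 6 by rewrite -sA index_mem.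
have yi : index y (enum A) < 6 by rewrite -sA index_mem.
have nx := nth_index x0 xA; have ny := nth_index x0 yA.
have ax : index x (enum A) != a by apply: contraNneq xv => <-; rewrite nx.
have ay : index y (enum A) != a by apply: contraNneq yv => <-; rewrite ny.
have xi' : index x (enum A) \in iota 0 6 by rewrite mem_iota.
have yi' : index y (enum A) \in iota 0 6 by rewrite mem_iota.
have := allP (fa _ xi') _ yi'; rewrite (negPf ax) (negPf ay) fcol.
- by rewrite nx ny => /eqP.
- by rewrite /colored; lia.
- by rewrite /colored; lia.
Qed.

(** If at most one color of [col] lay on adjacent edges, the renamed coloring [f] would inherit
    this, contrary to the goal of the search. *)
Lemma cherries5 (A : {set T}) : #|A| = 5 -> 1 < #|cherries A|.
Proof.
move=> A5; have /card_gt0P[x0 x0A] : 0 < #|A| by rewrite A5.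
have sA : size (enum A) = 5 by rewrite -cardE.
have := @set_search A (cherries_goal 5) 10 x0 x0A.
rewrite A5 => /(_ search_cherries)[f goal_f fcol].
set g := (fun a b => _) in fcol.
rewrite ltnNge; apply: contra goal_f => /card_le1_eqP one.
have e v x y v' x' y' : uniq [:: v; x; y] -> uniq [:: v'; x'; y'] ->
    all (gtn 5) [:: v; x; y] -> all (gtn 5) [:: v'; x'; y'] ->
    f v x == f v y -> f v' x' == f v' y' -> f v x = f v' x'.
  have ch u w z : uniq [:: u; w; z] -> all (gtn 5) [:: u; w; z] ->
      f u w == f u z -> g u w \in cherries A.
    move=> uwz u5 fu.
    have inA a : a \in [:: u; w; z] -> nth x0 (enum A) a \in A.
      by move=> /(allP u5) a5; rewrite -mem_enum mem_nth ?sA.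
    apply: (@cherryP _ _ _ (nth x0 (enum A) z)); try by apply: inA; rewrite !inE eqxx ?orbT.
      apply: (@uniq_nth x0 _ (enum_uniq A) [:: u; w; z]) => //.
      by move=> a /(allP u5); rewrite sA.
    apply/eqP; rewrite -/(g u w) -/(g u z) -fcol //.
    - by move: uwz u5; rewrite /colored /= !inE; lia.
    - by move: uwz u5; rewrite /colored /= !inE; lia.
  move=> u u' u5 u5' fu fu'; apply/eqP; rewrite fcol.
  - by apply/eqP/one; apply: ch fu || apply: ch fu'.
  - by move: u u5; rewrite /colored /= !inE; lia.
  - by move: u' u5'; rewrite /colored /= !inE; lia.
have all_eq (r : seq nat) : {in r &, forall a b, a = b} -> constant r.
  by case: r => //= a r er; apply/allP=> b br /=; rewrite (er b a) ?inE ?br ?eqxx ?orbT.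
apply: all_eq => _ _ /mapP[[v [x y]] p_in ->] /mapP[[v' [x' y']] p_in' ->].
have in5 : {in [seq (v, q) | v <- iota 0 5, q <- [seq (x, y) | x <- iota 0 5, y <- iota 0 5]],
    forall p, all (gtn 5) [:: p.1; p.2.1; p.2.2]} by exact/allP.
move: p_in p_in'; rewrite !mem_filter => /andP[/andP[p_u p_f] /in5 p5].
move=> /andP[/andP[p_u' p_f'] /in5 p5'].
exact: e p_u p_u' p5 p5' p_f p_f'.
Qed.

Ltac distinct := rewrite /= ?inE ?negb_or;
  repeat (apply/andP; split); done || (rewrite eq_sym; done).

(** Let [d] be the common color from [v] to [B]. If neither [v] nor [x] dominates [A], then [x v] is
    not [d] and some [x y0] differs from [x v], which forces [x y0] to be [d]. Every other [y] in
    [B] then has [x y] colored like [x v], and [y y0] has the color of [x v] or [d]. Each of these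
    two colors can occur only once at [y0], but at least four such [y] exist. *)
Lemma dominated (A : {set T}) : 6 <= #|A| -> exists2 v, v \in A & dominates v A.
Proof.
move=> /subnKC; move: (#|A| - 6) => n; elim: n A => [|n IHn] A cA.
  by apply: dominated6; rewrite -cA.
have /card_gt0P[x xA] : 0 < #|A| by rewrite -cA.
have /IHn[v] : 6 + n = #|A :\ x| by move: cA; rewrite (cardsD1 x A) xA; lia.
rewrite in_setD1 => /andP[vx vA] dom_v.
set B := A :\ x :\ v.
have cB : 4 < #|B|.
  by move: cA; rewrite (cardsD1 x A) xA (cardsD1 v (A :\ x)) in_setD1 vx vA -/B; lia.
have inB y : y \in B -> [/\ y != v, y != x & y \in A] by rewrite !in_setD1 => /and3P.
have inA y : y \in A -> [\/ y = x, y = v | y \in B].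
  rewrite !in_setD1; case: (y =P x) => [|_]; first by constructor 1.
  by case: (y =P v) => [|_]; [constructor 2 | constructor 3].
have vB y z : y \in B -> z \in B -> col v y = col v z by exact: dom_v.
case: (boolP [exists y0 in B, col x y0 != col x v]) => [|none]; last first.
  exists x => // y z; rewrite !in_setD1.
  suff xB u : u != x -> u \in A -> col x u = col x v.
    by move=> /andP[? ?] /andP[? ?]; rewrite !xB.
  move=> ux /inA[e|->//|uB]; first by rewrite e eqxx in ux.
  by move: none; rewrite negb_exists_in => /forall_inP/(_ u uB); rewrite negbK => /eqP.
move=> /exists_inP[y0 y0B xy0]; have [y0v y0x _] := inB _ y0B.
case: (col x v =P col v y0) => [xv|/eqP xv].
  exists v => // y z; rewrite !in_setD1.
  suff vA' u : u != v -> u \in A -> col v u = col v y0.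
    by move=> /andP[? ?] /andP[? ?]; rewrite !vA'.
  move=> uv /inA[->|e|uB]; first by rewrite colC.
  - by rewrite e eqxx in uv.
  - exact: vB.
have xy0v : col x y0 = col v y0.
  have /gallai : uniq [:: x; v; y0] by distinct.
  by rewrite (negPf xv) [col x v == _]eq_sym (negPf xy0) orbF => /eqP.
(* Otherwise [x y] has color [d] and [x y v y0] is a 4-cycle of that color. *)
have xB y : y \in B :\ y0 -> col x y = col x v.
  rewrite in_setD1 => /andP[yy0 yB]; have [yv yx _] := inB _ yB.
  have /gallai : uniq [:: x; v; y] by distinct.
  have vyy0 := vB _ _ yB y0B.
  rewrite vyy0 (negPf xv) /= => /orP[/eqP xy|/eqP//].
  have /noC4/negP[] : uniq [:: x; y; v; y0] by distinct.
  by rewrite -xy (colC y) vyy0 (colC y0) xy0v !eqxx.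
have y0B2 y : y \in B :\ y0 -> col y y0 = col x v \/ col y y0 = col v y0.
  move=> yB; have xyv := xB _ yB; move: yB; rewrite in_setD1 => /andP[yy0 yB].
  have [yv yx _] := inB _ yB.
  have /gallai : uniq [:: x; y; y0] by distinct.
  rewrite xyv xy0v (negPf xv) orbF => /orP[/eqP|/eqP]; by [left|right].
have no_two y z : y \in B :\ y0 -> z \in B :\ y0 -> y != z -> col y y0 <> col z y0.
  move=> yB zB yz e; have [xy xz] := (xB _ yB, xB _ zB).
  have yv := y0B2 _ yB; case/setD1P: yB => yy0 yB; case/setD1P: zB => zy0 zB.
  have [yv' yx _] := inB _ yB; have [zv zx _] := inB _ zB.
  (* A repeated color at [y0] closes a 4-cycle through [x] if it is the color of [x v], and through
     [v] if it is [d]. *)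
  case: yv => yc.
    have /noC4/negP[] : uniq [:: x; y; y0; z] by distinct.
    by rewrite xy yc (colC y0) -e yc (colC z) xz !eqxx.
  have /noC4/negP[] : uniq [:: v; y; y0; z] by distinct.
  by rewrite (vB _ _ yB y0B) yc (colC y0) -e yc (colC z) (vB _ _ zB y0B) !eqxx.
have /card_gt2P[y1 [y2 [y3 [[y1B y2B y3B] [y12 y23 y31]]]]] : 2 < #|B :\ y0|.
  by move: cB; rewrite (cardsD1 y0 B) y0B; lia.
have := (no_two _ _ y1B y2B y12, no_two _ _ y2B y3B y23, no_two _ _ y3B y1B y31).
by case: (y0B2 _ y1B) => ->; case: (y0B2 _ y2B) => ->; case: (y0B2 _ y3B) => -> [[]].
Qed.

(** On four vertices, any triangle has two edges of one color, which gives the single color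
    required. Five vertices use the search, and from six on a dominating vertex is deleted. *)
Lemma card_le_cherries (A : {set T}) : #|A| <= #|cherries A| + 3.
Proof.
have [n] := ubnP #|A|; elim: n A => // n IHn A An.
case: (leqP #|A| 3) => [|A3]; first by lia.
case: (ltnP 5 #|A|) => [A6|A5]; last first.
  case: (#|A| =P 5) => [/[dup] /cherries5|]; first by lia.
  move=> A5'; suff : 0 < #|cherries A| by lia.
  have /card_gt2P[x [y [z [[xA yA zA] [xy yz zx]]]]] : 2 < #|A| by lia.
  have /gallai/or3P : uniq [:: x; y; z] by distinct.
  case=> /eqP e.
  - by apply/card_gt0P; exists (col y x); apply: (@cherryP _ y x z); rewrite // ?(colC y x) //; distinct.
  - by apply/card_gt0P; exists (col z y); apply: (@cherryP _ z y x); rewrite ?(colC z) //; distinct.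
  - by apply/card_gt0P; exists (col x y); apply: (@cherryP _ x y z) => //; distinct.
have [v vA dom_v] := dominated A6.
have /card_gt2P[x [y [z [[xA yA _] [xy _ _]]]]] : 2 < #|A :\ v|.
  by move: A6; rewrite (cardsD1 v A) vA; lia.
have vcol u : u \in A :\ v -> col v u = col v x by move=> uA; apply: dom_v.
suff : cherries (A :\ v) \proper cherries A.
  move=> /proper_card; have := IHn (A :\ v).
  by move: An; rewrite (cardsD1 v A) vA; lia.
apply/properP; split.
  apply/subsetP=> c; rewrite !inE => /exists_inP[u uA /exists_inP[w wA /exists_inP[t tA ut]]].
  apply/exists_inP; exists u; first by case/setD1P: uA.
  apply/exists_inP; exists w; first by case/setD1P: wA.
  by apply/exists_inP; exists t => //; case/setD1P: tA.
exists (col v x).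
  move: xA yA; rewrite !in_setD1 => /andP[xv xA'] /andP[yv yA'].
  apply: (@cherryP _ v x y) => //; first by distinct.
  by apply: esym; apply: vcol; rewrite in_setD1 yv.
rewrite inE; apply/negP=> /exists_inP[u uA /exists_inP[w wA /exists_inP[t tA]]].
case/and3P=> uwt /eqP uw /eqP ut.
have [wv tv] := (vcol _ wA, vcol _ tA).
move: uA wA tA uwt; rewrite !in_setD1 /= !inE !negb_or.
move=> /andP[uv _] /andP[wv' _] /andP[tv' _] /and3P[/andP[uw' ut'] wt' _].
have /noC4/negP[] : uniq [:: v; w; u; t] by distinct.
by rewrite wv (colC w) uw ut (colC t) tv !eqxx.
Qed.

Lemma card_le_colors : #|T| <= #|C| + 3.
Proof.
by rewrite -cardsT (leq_trans (card_le_cherries _)) ?leq_add2r ?max_card.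
Qed.

End Coloring.

(** * From colorings to the Ramsey numbers *)

Lemma edge_in (G : sgraph) (x y : G) : adj x y -> [set x; y] \in edges G.
Proof. by move=> xy; rewrite inE; apply/existsP; exists x; apply/existsP; exists y; rewrite xy /=. Qed.

Lemma edgeP (G : sgraph) (e : {set G}) :
  e \in edges G -> exists x y, adj x y /\ e = [set x; y].
Proof. by rewrite inE => /existsP[x /existsP[y /andP[xy /eqP ->]]]; exists x, y. Qed.

Lemma imset_pair (S T : finType) (f : S -> T) x y : f @: [set x; y] = [set f x; f y].
Proof. by rewrite imsetU1 imset_set1. Qed.

Lemma rainbow_triangle (G : sgraph) (c : {set G} -> nat) x y z :
  adj x y -> adj y z -> adj x z ->
  c [set x; y] != c [set y; z] -> c [set y; z] != c [set x; z] ->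
  c [set x; y] != c [set x; z] -> has_rainbow (complete 3) c.
Proof.
move=> xy yz xz cxy cyz cxz; pose f (i : complete 3) := nth x [:: x; y; z] i.
have adj_f i j : i != j -> adj (f i) (f j).
  by case: i j => [[|[|[|?]]] ?] [[|[|[|?]]] ?] //= _; rewrite /f /= // adj_sym.
exists f; split.
  split=> [i j fij|i j]; last exact: adj_f.
  by apply/eqP/negPn/negP=> /adj_f; rewrite fij adj_irrefl.
have ordE i (hi : i < 3) : Ordinal hi = inord i :> 'I_3 by apply: val_inj; rewrite /= inordK.
have edge3 e : e \in edges (complete 3) ->
    [\/ e = [set inord 0; inord 1], e = [set inord 1; inord 2] | e = [set inord 0; inord 2]].
  case/edgeP=> [[[|[|[|?]]] hi] [[[|[|[|?]]] hj] [//= _ ->]]]; rewrite !ordE;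
  by [constructor 1|constructor 2|constructor 3
     |rewrite setUC; constructor 1|rewrite setUC; constructor 2|rewrite setUC; constructor 3].
have fE i j : i < 3 -> j < 3 -> f @: [set inord i; inord j] = [set nth x [:: x; y; z] i; nth x [:: x; y; z] j].
  by move=> i3 j3; rewrite imset_pair /f !inordK.
by move=> e1 e2 /edge3[]-> /edge3[]->; rewrite ?eqxx // !fE // => _; apply/eqP; rewrite // eq_sym.
Qed.

Lemma mono_C4 (G : sgraph) (c : {set G} -> nat) x y z w :
  uniq [:: x; y; z; w] -> adj x y -> adj y z -> adj z w -> adj w x ->
  c [set x; y] = c [set y; z] -> c [set y; z] = c [set z; w] ->
  c [set z; w] = c [set w; x] -> has_monochromatic C4 c.
Proof.
move=> u xy yz zw wx cxy cyz czw; pose f (i : C4) := nth x [:: x; y; z; w] i.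
have fS i : adj (f i) (f (ordS i)) /\ c [set f i; f (ordS i)] = c [set x; y].
  case: i => [[|[|[|[|?]]]] hi] //=; rewrite /f /=; split=> //; congruence.
exists f; split.
  split=> [i j /eqP|i j /orP[/eqP ->|/eqP ->]]; last by rewrite adj_sym (fS j).1.
  - by rewrite nth_uniq //= ?ltn_ord // => /eqP/val_inj.
  - exact: (fS i).1.
have ce e : e \in edges C4 -> c (f @: e) = c [set x; y].
  case/edgeP=> i [j [/orP[/eqP ->|/eqP ->] ->]]; rewrite imset_pair; first exact: (fS i).2.
  by rewrite setUC (fS j).2.
by move=> e1 e2 /ce -> /ce ->.
Qed.

Lemma forces_complete k (G : sgraph) :
  (forall x y : G, x != y -> adj x y) -> k.+1 + 3 < #|G| -> forces k.+1 C4 G.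
Proof.
(* Edge colors start at 1, hence the predecessor. The diagonal may receive a default value, so
   [colE] compares colors of distinct vertices only. *)
move=> adjG cG c ck; pose col x y : 'I_k.+1 := inord (c [set x; y]).-1.
have colC x y : col x y = col y x by rewrite /col setUC.
have colE x y z w : x != y -> z != w -> (col x y == col z w) = (c [set x; y] == c [set z; w]).
  move=> /adjG/edge_in/ck xy /adjG/edge_in/ck zw.
  rewrite -val_eqE /= !inordK; lia.
(* Stated over tuples from a finite type, each condition is decidable, and its failure provides the
   vertices of a rainbow triangle or a monochromatic 4-cycle. *)
pose gal (p : G * G * G) := let: (x, y, z) := p in uniq [:: x; y; z] ==>
  [|| col x y == col y z, col y z == col x z | col x y == col x z].
pose no4 (p : (G * G) * (G * G)) := let: (x, y, (z, w)) := p in uniq [:: x; y; z; w] ==>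
  ~~ [&& col x y == col y z, col y z == col z w & col z w == col w x].
case: (boolP [forall p, gal p]) => [/forallP galP|]; last first.
  rewrite negb_forall => /existsP[[[x y] z]]; rewrite /= negb_imply /= !inE !negb_or.
  case/andP=> /and3P[/andP[xy xz] yz _] /and3P[]; rewrite !colE // => *; left.
  by apply: (@rainbow_triangle _ _ x y z) => //; apply: adjG.
case: (boolP [forall p, no4 p]) => [/forallP no4P|]; last first.
  rewrite negb_forall => /existsP[[[x y] [z w]]]; rewrite /= negb_imply negbK.
  case/andP=> u; have := u; rewrite /= !inE !negb_or.
  case/and4P=> /and3P[xy xz xw] /andP[yz yw] zw _.
  have wx : w != x by rewrite eq_sym.
  rewrite !colE // => /and3P[/eqP ? /eqP ? /eqP ?]; right.
  by apply: (@mono_C4 _ _ x y z w u) => //; apply: adjG.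
move: cG; rewrite ltnNge => /negP[].
rewrite -{1}(card_ord k.+1).
apply: (@card_le_colors G 'I_k.+1 col colC) => [x y z|x y z w] u.
- by have := galP (x, y, z); rewrite /gal u.
- by have := no4P (x, y, (z, w)); rewrite /no4 u.
Qed.

(** * The coloring for the lower bound *)

(* For labels below 6 this is a coloring of K_6 minus the edge 01.  The value 0
   on the diagonal lets [not_forces] read off the color of an edge as the maximum
   over all ordered pairs of its vertices. *)
Definition label_color (i j : nat) : nat :=
  if i == j then 0 else if 6 <= maxn i j then maxn i j - 3 else
  if (minn i j, maxn i j) \in [:: (0, 2); (0, 3); (2, 3); (1, 4); (3, 4); (1, 5); (2, 5)]
  then 1 else 2.

(** The pair 01 is the only pair of distinct labels whose maximum is at most 1. *)
Definition non_missing (i j : nat) : bool := (i != j) && (1 < maxn i j).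

Lemma label_colorC i j : label_color i j = label_color j i.
Proof. by rewrite /label_color maxnC minnC eq_sym. Qed.

Lemma label_colorE i j : non_missing i j ->
  (maxn i j < 6) && (label_color i j <= 2)
  || (6 <= maxn i j) && (label_color i j == maxn i j - 3).
Proof.
rewrite /label_color => /andP[/negPf -> _].
by case: (leqP 6) => //= _; case: ifP.
Qed.

(** If the largest label is at least 6, the two edges at it have the same color. Below 6 only two
    colors are available for three edges. *)
Lemma label_color_gallai i j l : non_missing i j -> non_missing j l -> non_missing i l ->
  [|| label_color i j == label_color j l, label_color j l == label_color i l
    | label_color i j == label_color i l].
Proof.
move=> ij jl il; case: (boolP [&& i < 6, j < 6 & l < 6]) => [/and3P[i6 j6 l6]|big].
  have /allP small : all (fun i => all (fun j => all (fun l =>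
      [&& non_missing i j, non_missing j l & non_missing i l] ==>
      [|| label_color i j == label_color j l, label_color j l == label_color i l
        | label_color i j == label_color i l])
      (iota 0 6)) (iota 0 6)) (iota 0 6) by [].
  have iota6 a : a < 6 -> a \in iota 0 6 by rewrite mem_iota.
  have := allP (allP (small _ (iota6 _ i6)) _ (iota6 _ j6)) _ (iota6 _ l6).
  by rewrite ij jl il.
move: (label_colorE ij) (label_colorE jl) (label_colorE il).
move: ij jl il big; rewrite /non_missing; lia.
Qed.

(** On labels below 6, each of the two color classes is a pentagon with a triangle glued to one
    side, whose cycles have lengths 3, 5 and 6. A color [c > 2] forms a star centred at label
    [c + 3], which contains no cycle. *)
Lemma label_color_C4 i j l m : uniq [:: i; j; l; m] ->
  non_missing i j -> non_missing j l -> non_missing l m -> non_missing m i ->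
  ~~ [&& label_color i j == label_color j l, label_color j l == label_color l m
       & label_color l m == label_color m i].
Proof.
move=> u ij jl lm mi.
case: (boolP [&& i < 6, j < 6, l < 6 & m < 6]) => [/and4P[i6 j6 l6 m6]|big].
  have /allP small : all (fun i => all (fun j => all (fun l => all (fun m =>
      [&& uniq [:: i; j; l; m], non_missing i j, non_missing j l, non_missing l m
        & non_missing m i] ==>
      ~~ [&& label_color i j == label_color j l, label_color j l == label_color l m
           & label_color l m == label_color m i])
      (iota 0 6)) (iota 0 6)) (iota 0 6)) (iota 0 6) by vm_compute.
  have iota6 a : a < 6 -> a \in iota 0 6 by rewrite mem_iota.
  have := allP (allP (allP (small _ (iota6 _ i6)) _ (iota6 _ j6)) _ (iota6 _ l6)) _ (iota6 _ m6).
  by rewrite u ij jl lm mi.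
apply/negP=> /and3P[/eqP eij /eqP ejl /eqP elm].
move: (label_colorE ij) (label_colorE jl) (label_colorE lm) (label_colorE mi).
rewrite eij ejl elm; move: (label_color m i) => c Eij Ejl Elm Emi.
have {big} c3 : 2 < c by lia.
have {Eij} Mij : maxn i j = c + 3 by lia.
have {Ejl} Mjl : maxn j l = c + 3 by lia.
have {Elm} Mlm : maxn l m = c + 3 by lia.
have {Emi} Mmi : maxn m i = c + 3 by lia.
by clear - u Mij Mjl Mlm Mmi; move: u; rewrite /= !inE; lia.
Qed.

(** The map [phi] embeds [G] into K_{k+4} minus the edge 01, and the coloring is pulled back. The
    largest label [k + 3] yields color [k], so the palette suffices. *)
Lemma not_forces k (G : sgraph) (phi : G -> nat) : 2 <= k -> injective phi ->
  (forall x, phi x < k + 4) -> (forall x y, adj x y -> non_missing (phi x) (phi y)) ->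
  ~ forces k C4 G.
Proof.
move=> k2 phi_inj phi_lt phi_adj.
pose c (e : {set G}) := \max_(x in e) \max_(y in e) label_color (phi x) (phi y).
have cE x y : adj x y -> c [set x; y] = label_color (phi x) (phi y).
  move=> xy; have nxy : x != y by apply: contraTneq xy => ->; rewrite adj_irrefl.
  rewrite /c !big_setU1 ?inE //= !big_set1 !big_setU1 ?inE //= !big_set1.
  by rewrite (label_colorC (phi y)) /label_color !eqxx max0n maxn0 maxnn.
move/(_ c); case.
- move=> _ /edgeP[x [y [xy ->]]]; rewrite cE //.
  have := phi_adj _ _ xy; rewrite /label_color /non_missing => /andP[/negPf -> _].
  by move: (phi_lt x) (phi_lt y); case: ifP => [|_]; [lia | case: ifP; lia].
- case=> f [[f_inj f_adj] rb].
  have a01 : adj (inord 0 : complete 3) (inord 1) by rewrite /= -val_eqE /= !inordK.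
  have a12 : adj (inord 1 : complete 3) (inord 2) by rewrite /= -val_eqE /= !inordK.
  have a02 : adj (inord 0 : complete 3) (inord 2) by rewrite /= -val_eqE /= !inordK.
  have rbE a b a' b' : adj a b -> adj a' b' -> [set a; b] != [set a'; b'] ->
      c [set f a; f b] = c [set f a'; f b'] -> False.
    by move=> /edge_in ab /edge_in ab'; rewrite -!imset_pair; apply: rb.
  have := label_color_gallai (phi_adj _ _ (f_adj _ _ a01)) (phi_adj _ _ (f_adj _ _ a12))
    (phi_adj _ _ (f_adj _ _ a02)).
  rewrite -!cE ?f_adj // => /or3P[]/eqP; apply: rbE => //.
  + by apply/eqP=> /setP/(_ (inord 0)); rewrite !inE -!val_eqE /= !inordK.
  + by apply/eqP=> /setP/(_ (inord 0)); rewrite !inE -!val_eqE /= !inordK.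
  + by apply/eqP=> /setP/(_ (inord 1)); rewrite !inE -!val_eqE /= !inordK.
- case=> f [[f_inj f_adj] mono].
  have aS (i : C4) : adj i (ordS i) by rewrite /= /C4_adj eqxx.
  (* [o] walks around the cycle and returns to its start at [o 4]. *)
  pose o0 : C4 := ord0; pose o i := iter i (@ordS 4) o0.
  have oE i : i < 4 -> o i = i :> nat by case: i => [|[|[|[|?]]]].
  have o4 : o 4 = o0 by apply: val_inj.
  have nm i : non_missing (phi (f (o i))) (phi (f (o i.+1))) by exact/phi_adj/f_adj/aS.
  have lE i j : label_color (phi (f (o i))) (phi (f (o i.+1))) =
      label_color (phi (f (o j))) (phi (f (o j.+1))).
    rewrite -!cE; try exact/f_adj/aS.
    by rewrite -!imset_pair; apply: mono; apply/edge_in/aS.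
  have u : uniq [seq phi (f (o i)) | i <- iota 0 4].
    rewrite map_inj_in_uniq // => a b; rewrite !mem_iota => /andP[_ a4] /andP[_ b4].
    by move=> /phi_inj/f_inj/(congr1 val) /=; rewrite !oE.
  have [nm3 lE3] := (nm 3, lE 2 3); rewrite o4 in nm3 lE3.
  case/negP: (label_color_C4 u (nm 0) (nm 1) (nm 2) nm3).
  by apply/and3P; split; apply/eqP; [exact: lE 0 1|exact: lE 1 2|].
Qed.

Theorem theorem3p3 (k : nat) (hk : 2 <= k) :
  star_critical_gallai_ramsey k C4 (k + 3).
Proof.
have upper (G : sgraph) : (forall x y : G, x != y -> adj x y) -> #|G| = k + 4 -> forces k C4 G.
  case: k hk => // k' _ adjG cG; apply: forces_complete => //; lia.
exists (k + 4); split; split.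
- by apply: upper; rewrite ?card_ord.
- move=> m fm; rewrite leqNgt; apply/negP=> mk.
  (* Skipping label 0 avoids the missing edge 01, and the labels stay below [k + 4] because
     [m < k + 4]. *)
  apply: (@not_forces k (complete m) (fun i => i.+1)) fm => //.
  + by move=> i j [/val_inj].
  + by move=> i; have := ltn_ord i; lia.
  + by move=> i j; rewrite /= /non_missing -val_eqE /=; lia.
- split; first by lia.
  (* With [s = k + 3] the new vertex is joined to every old one, so the graph is complete on [k + 4]
     vertices. *)
  apply: upper => [[x|] [y|] //= _|].
  + by have := ltn_ord x; lia.
  + by have := ltn_ord y; lia.
  + by rewrite card_option card_ord; lia.
- move=> s [_ fs]; rewrite leqNgt; apply/negP=> sk.
  (* The new vertex gets label 0. Reversing the others gives label 1 to the last vertex, [k + 2],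
     which is not a neighbour of the new one since [s < k + 3]. *)
  apply: (@not_forces k (complete_star (k + 4).-1 s)
    (fun x => if x is Some i then k + 3 - i else 0)) fs => //.
  + case=> [i|] [j|] //; try have := ltn_ord i; try have := ltn_ord j; try lia.
    by move=> ? ? ?; congr Some; apply: val_inj => /=; lia.
  + by case=> [i|]; lia.
  + case=> [i|] [j|] //=; rewrite /non_missing; try have := ltn_ord i; try have := ltn_ord j; try lia.
    by rewrite -val_eqE /=; lia.
Qed.
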